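(* Let $S$ be a $\Gamma$-semiring which has a left unity and a right unity, and let $L$ be its left operator semiring. For a fuzzy subset $\sigma$ of $S$ let $\sigma^{+'}$ be the fuzzy subset of $L$ defined by $\sigma^{+'}(\sum_i[x_i,\alpha_i])=\inf_{a\in S}\sigma(\sum_i x_i\alpha_i a)$. Then the map $\sigma\mapsto\sigma^{+'}$ is an inclusion preserving bijection from the set of all fuzzy $k$-ideals of $S$ to the set of all fuzzy $k$-ideals of $L$. Likewise, the map $\sigma\mapsto\sigma^{+'}$ is an inclusion preserving bijection from the set of all fuzzy $h$-ideals of $S$ to the set of all fuzzy $h$-ideals of $L$.
   Context: $\Gamma$-semiring: $S$ and $\Gamma$ are (nonempty) additive commutative semigroups with a map $S\times\Gamma\times S\to S$, $(a,\alpha,b)\mapsto a\alpha b$, such that $a\alpha(b+c)=a\alpha b+a\alpha c$, $(a+b)\alpha c=a\alpha c+b\alpha c$, $a(\alpha+\beta)c=a\alpha c+a\beta c$, $a\alpha(b\beta c)=(a\alpha b)\beta c$ for all $a,b,c\in S$, $\alpha,\beta\in\Gamma$. No zero elements are assumed. Left operator semiring $L$: let $F$ be the free additive commutative semigroup generated by $S\times\Gamma$ (finite nonempty formal sums). The relation $\sum_i(x_i,\alpha_i)\,\rho\,\sum_j(y_j,\beta_j)$ iff $\sum_i x_i\alpha_i a=\sum_j y_j\beta_j a$ for all $a\in S$ is a congruence on $F$. The class of $\sum_i(x_i,\alpha_i)$ is written $\sum_i[x_i,\alpha_i]$. $L=F/\rho$ with the induced addition and the multiplication $(\sum_i[x_i,\alpha_i])(\sum_j[y_j,\beta_j])=\sum_{i,j}[x_i\alpha_i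 y_j,\beta_j]$ is a semiring. Unities: a left unity of $S$ is a finite sum $\sum_i[e_i,\delta_i]\in L$ with $\sum_i e_i\delta_i a=a$ for all $a\in S$. A right unity of $S$ is given by finitely many $\gamma_j\in\Gamma$, $f_j\in S$ with $\sum_j a\gamma_j f_j=a$ for all $a\in S$. A fuzzy subset of a set $X$ is a function $X\to[0,1]$; inclusion of fuzzy subsets is the pointwise order ($\sigma\le\tau$ iff $\sigma(x)\le\tau(x)$ for all $x$). Inclusion preserving means $\sigma\le\tau$ implies $\sigma^{+'}\le\tau^{+'}$. A fuzzy subset $\mu$ of $S$ is a fuzzy ideal of $S$ if $\mu(a+b)\ge\min(\mu(a),\mu(b))$, $\mu(a\alpha b)\ge\mu(a)$ and $\mu(a\alpha b)\ge\mu(b)$ for all $a,b\in S$, $\alpha\in\Gamma$. A fuzzy subset $\mu$ of $L$ is a fuzzy ideal of $L$ if $\mu(p+q)\ge\min(\mu(p),\mu(q))$, $\mu(pq)\ge\mu(p)$ and $\mu(pq)\ge\mu(q)$ for all $p,q\in L$. A fuzzy ideal $\mu$ (of $S$ or of $L$) is a fuzzy $k$-ideal if $\mu(x)\ge\min(\mu(x+y),\mu(y))$ for all $x,y$ (in $S$, respectively in $L$); it is a fuzzy $h$-ideal if for all $x,z,y_1,y_2$ (in $S$, respectively in $L$), $x+y_1+z=y_2+z$ implies $\mu(x)\ge\min(\mu(y_1),\mu(y_2))$. *)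

(* Defs.v *)
From HB Require Import structures.
From mathcomp Require Import all_boot all_order all_algebra finmap multiset.
From mathcomp Require Import all_classical all_reals.

Set Implicit Arguments.
Unset Strict Implicit.
Unset Printing Implicit Defensive.

Local Open Scope ring_scope.
Local Open Scope classical_set_scope.
Local Open Scope quotient_scope.
Local Open Scope mset_scope.

(* [addSemigroupType] is MathComp's structure of commutative additive
   semigroups; it has no zero. Its laws are [Algebra.addrC] and
   [Algebra.addrA]: those of [GRing.Theory] are specialised to [nmodType]. *)
HB.mixin Record isGammaSemiring (G : addSemigroupType) S
    of Algebra.AddSemigroup S := {
  gamma_nonempty : inhabited G;
  carrier_nonempty : inhabited S;
  gmul : S -> G -> S -> S;
  gmulDr : forall (a : S) (al : G) (b c : S),
    gmul a al (b + c) = gmul a al b + gmul a al c;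
  gmulDl : forall (a b : S) (al : G) (c : S),
    gmul (a + b) al c = gmul a al c + gmul b al c;
  gmulDm : forall (a : S) (al be : G) (c : S),
    gmul a (al + be) c = gmul a al c + gmul a be c;
  gmulA : forall (a : S) (al : G) (b : S) (be : G) (c : S),
    gmul a al (gmul b be c) = gmul (gmul a al b) be c
}.

#[short(type="gammaSemiringType")]
HB.structure Definition GammaSemiring (G : addSemigroupType) :=
  {S of isGammaSemiring G S & Algebra.AddSemigroup S}.

Section SemigroupSum.
Variable V : addSemigroupType.

(* A semigroup has no empty sum: [None] stands for it, and [oAC] extends + to
   [option V] with [None] as neutral element. *)
Definition osum (s : seq V) : option V :=
  \big[oAC (@Algebra.addrA V) (@Algebra.addrC V)/None]_(x <- s) Some x.

(* The sum of the nonempty sequence [s]; [x0] is the junk value at [::]. *)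
Definition ssum (x0 : V) (s : seq V) : V := odflt x0 (osum s).

Lemma osum_cons x s : osum (x :: s) = Some (oapp (+%R x) x (osum s)).
Proof. by rewrite /osum big_cons; case: (\big[_/_]_(_ <- _) _). Qed.

Lemma osum_some s : s != [::] -> exists x, osum s = Some x.
Proof. by case: s => // x s _; rewrite osum_cons; eexists. Qed.

Lemma ssum_perm x0 s t : perm_eq s t -> ssum x0 s = ssum x0 t.
Proof. by move=> st; rewrite /ssum /osum (perm_big _ st). Qed.

Lemma ssum1 x0 x : ssum x0 [:: x] = x.
Proof. by rewrite /ssum /osum big_seq1. Qed.

Lemma ssum_cons x0 x s : s != [::] -> ssum x0 (x :: s) = x + ssum x0 s.
Proof. by move=> /osum_some[y sy]; rewrite /ssum osum_cons sy. Qed.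

Lemma ssum_cat x0 s t : s != [::] -> t != [::] ->
  ssum x0 (s ++ t) = ssum x0 s + ssum x0 t.
Proof.
move=> /osum_some[x sx] /osum_some[y ty].
have st : osum (s ++ t) = Some (x + y).
  by rewrite -(oACE (@Algebra.addrA V) (@Algebra.addrC V)) -sx -ty /osum big_cat.
by rewrite /ssum sx ty st.
Qed.

End SemigroupSum.

Lemma ssum_morph (U V : addSemigroupType) (f : U -> V) (x0 : U) (y0 : V) s :
  {morph f : x y / x + y} -> s != [::] ->
  f (ssum x0 s) = ssum y0 [seq f x | x <- s].
Proof.
move=> fD; elim: s => // x [|y s] IH _; first by rewrite !ssum1.
by rewrite ssum_cons // fD IH //= [RHS]ssum_cons.
Qed.

(* The free commutative semigroup on T: nonempty finite multisets. *)
Section FreeSemigroup.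
Variable T : choiceType.

Definition fsg := {m : {mset T} | m != mset0}.
HB.instance Definition _ := Choice.on fsg.

Definition fsg_seq (u : fsg) : seq T := val u.

Lemma fsg_seq_neq0 u : fsg_seq u != [::].
Proof. by rewrite -size_eq0 size_mset_eq0 (valP u). Qed.

Lemma seq_mset_neq0 (s : seq T) : s != [::] -> seq_mset s != mset0.
Proof. by rewrite -size_mset_eq0 (perm_size (perm_eq_seq_mset s)) size_eq0. Qed.

Definition fsg_of_seq (s : seq T) (s0 : s != [::]) : fsg :=
  exist _ (seq_mset s) (seq_mset_neq0 s0).

Lemma perm_fsg_of_seq s (s0 : s != [::]) : perm_eq (fsg_seq (fsg_of_seq s0)) s.
Proof. exact: perm_eq_seq_mset. Qed.

Lemma fsg_add_subproof (u v : fsg) : val u `+` val v != mset0.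
Proof.
have [x xu] : exists x, x \in val u.
  by case: (mset_0Vmem (val u)) (valP u) => [->|[x xu] _]; [rewrite eqxx | exists x].
apply/eqP => uv0; have := in_msetD (val u) (val v) x.
by rewrite uv0 in_mset0 xu.
Qed.

Definition fsg_add (u v : fsg) : fsg :=
  exist _ (val u `+` val v) (fsg_add_subproof u v).

Fact fsg_addC : commutative fsg_add.
Proof. by move=> u v; apply/val_inj; rewrite /= msetDC. Qed.

Fact fsg_addA : associative fsg_add.
Proof. by move=> u v w; apply/val_inj; rewrite /= msetDA. Qed.

HB.instance Definition _ := Algebra.isAddSemigroup.Build fsg fsg_addC fsg_addA.

Lemma perm_fsgD (u v : fsg) : perm_eq (fsg_seq (u + v)) (fsg_seq u ++ fsg_seq v).
Proof.
apply/allP => x _ /=; rewrite count_cat.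
by rewrite !count_mem_mset msetE2.
Qed.

End FreeSemigroup.

Section LeftOperator.
Variables (G : addSemigroupType) (S : gammaSemiringType G).
Implicit Types (u v : fsg (S * G)%type) (a b : S).

(* The formal sum of the (x_i, al_i) sends a to the sum of the x_i al_i a. *)
Definition fact u a : S :=
  ssum a [seq gmul p.1 p.2 a | p <- fsg_seq u].

Definition rho u v : bool := `[< forall a, fact u a = fact v a >].

Fact rho_refl : reflexive rho.
Proof. by move=> u; apply/asboolP. Qed.

Fact rho_sym : symmetric rho.
Proof. by move=> u v; apply/asboolP/asboolP => uv a. Qed.

Fact rho_trans : transitive rho.
Proof.
by move=> v u w /asboolP uv /asboolP vw; apply/asboolP => a; rewrite uv.
Qed.

Canonical rho_equiv := EquivRel rho rho_refl rho_sym rho_trans.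

Definition left_op := {eq_quot rho}.
HB.instance Definition _ := Choice.on left_op.
HB.instance Definition _ := EqQuotient.on left_op.

Definition lact (p : left_op) a : S := fact (repr p) a.

Lemma lact_pi u a : lact (\pi_left_op u) a = fact u a.
Proof.
rewrite /lact; case: piP => v /eqP; rewrite eqmodE => /asboolP uv.
by rewrite uv.
Qed.

Lemma lactP (p q : left_op) : (forall a, lact p a = lact q a) -> p = q.
Proof.
rewrite -[p]reprK -[q]reprK => pq; apply/eqP; rewrite eqmodE.
by apply/asboolP => a; have := pq a; rewrite !lact_pi.
Qed.

Lemma factD u v a : fact (u + v) a = fact u a + fact v a.
Proof.
rewrite /fact (ssum_perm _ (perm_map _ (perm_fsgD u v))) map_cat ssum_cat //.
  by rewrite -size_eq0 size_map size_eq0 fsg_seq_neq0.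
by rewrite -size_eq0 size_map size_eq0 fsg_seq_neq0.
Qed.

Lemma fact_add u a b : fact u (a + b) = fact u a + fact u b.
Proof.
rewrite /fact.
suff H x y z (f := fun (c : S) (p : S * G) => gmul p.1 p.2 c) :
    ssum z (map (f (a + b)) (fsg_seq u)) =
    ssum x (map (f a) (fsg_seq u)) + ssum y (map (f b) (fsg_seq u)) by exact: H.
elim: (fsg_seq u) (fsg_seq_neq0 u) => // p [|q s] IH _.
  by rewrite /= !ssum1 /f gmulDr.
move: (q :: s) (isT : q :: s != [::]) IH => t t0 /(_ t0) IH.
have tN c : map (f c) t != [::] by rewrite -size_eq0 size_map size_eq0.
rewrite /= !ssum_cons // IH.
by rewrite {1}/f gmulDr Algebra.addrACA.
Qed.

Fact fmul_subproof u v :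
  [seq (gmul p.1 p.2 q.1, q.2) | p <- fsg_seq u, q <- fsg_seq v] != [::].
Proof.
rewrite -size_eq0 size_allpairs muln_eq0 !size_eq0.
by rewrite !(negPf (fsg_seq_neq0 _)).
Qed.

Definition fmul u v : fsg (S * G)%type := fsg_of_seq (fmul_subproof u v).

Lemma factM u v a : fact (fmul u v) a = fact u (fact v a).
Proof.
rewrite {1}/fact (ssum_perm _ (perm_map _ (perm_fsg_of_seq _))).
have v0 := fsg_seq_neq0 v.
have E (p : S * G) :
    ssum a [seq gmul r.1 r.2 a | r <- [seq (gmul p.1 p.2 q.1, q.2) | q <- fsg_seq v]]
    = gmul p.1 p.2 (fact v a).
  rewrite /fact (@ssum_morph _ _ (gmul p.1 p.2) a a); first 1 last.
  - by move=> x y; rewrite gmulDr.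
  - by rewrite -size_eq0 size_map size_eq0.
  rewrite -!map_comp; congr ssum; apply: eq_map => q /=.
  by rewrite gmulA.
rewrite [RHS]/fact; elim: (fsg_seq u) (fsg_seq_neq0 u) => // p [|p' s] IH _.
  by rewrite allpairs_cons /= cats0 E ssum1.
rewrite allpairs_cons map_cat ssum_cat; first 1 last.
- by rewrite -size_eq0 !size_map size_eq0.
- by rewrite -size_eq0 size_map size_allpairs muln_eq0 !size_eq0 (negPf v0).
by rewrite E IH //= [RHS]ssum_cons.
Qed.

Definition ladd := lift_op2 left_op (+%R : fsg (S * G)%type -> _ -> _).
Definition lmul := lift_op2 left_op fmul.

Lemma pi_ladd : {morph \pi_left_op : u v / u + v >-> ladd u v}.
Proof.
move=> u v; unlock ladd; apply: lactP => a.
by rewrite !lact_pi !factD -!/(lact _ a) !lact_pi.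
Qed.
Canonical pi_ladd_morph := PiMorph2 pi_ladd.

Lemma pi_lmul : {morph \pi_left_op : u v / fmul u v >-> lmul u v}.
Proof.
move=> u v; unlock lmul; apply: lactP => a.
by rewrite !lact_pi !factM -![fact (repr _) _]/(lact _ _) !lact_pi.
Qed.
Canonical pi_lmul_morph := PiMorph2 pi_lmul.

Fact laddC : commutative ladd.
Proof.
move=> p q; rewrite -[p]reprK -[q]reprK -!pi_ladd.
by rewrite [_ + _]Algebra.addrC.
Qed.

Fact laddA : associative ladd.
Proof.
move=> p q r; rewrite -[p]reprK -[q]reprK -[r]reprK -!pi_ladd.
by rewrite [_ + _]Algebra.addrA.
Qed.

HB.instance Definition _ := Algebra.isAddSemigroup.Build left_op laddC laddA.

Lemma lactD (p q : left_op) a : lact (p + q) a = lact p a + lact q a.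
Proof. by rewrite -[p]reprK -[q]reprK -[_ + _]pi_ladd !lact_pi factD. Qed.

Lemma lact_add (p : left_op) a b : lact p (a + b) = lact p a + lact p b.
Proof. exact: fact_add. Qed.

Lemma lactM (p q : left_op) a : lact (lmul p q) a = lact p (lact q a).
Proof. by rewrite -[p]reprK -[q]reprK -pi_lmul !lact_pi factM. Qed.

Lemma lmulA : associative lmul.
Proof. by move=> p q r; apply: lactP => a; rewrite !lactM. Qed.

Lemma lmulDl (p q r : left_op) : lmul (p + q) r = lmul p r + lmul q r.
Proof. by apply: lactP => a; rewrite !(lactM, lactD). Qed.

Lemma lmulDr (p q r : left_op) : lmul p (q + r) = lmul p q + lmul p r.
Proof. by apply: lactP => a; rewrite !(lactM, lactD) lact_add. Qed.

End LeftOperator.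

Arguments left_op {G} S.
Arguments lact {G S}.
Arguments lmul {G S}.

Definition has_left_unity (G : addSemigroupType) (S : gammaSemiringType G) :=
  exists e : left_op S, forall a : S, lact e a = a.

Definition has_right_unity (G : addSemigroupType) (S : gammaSemiringType G) :=
  exists f : fsg (G * S)%type,
    forall a : S, ssum a [seq gmul a p.1 p.2 | p <- fsg_seq f] = a.

Section Fuzzy.
Variable R : realType.

Definition fuzzy_subset (X : Type) (mu : X -> R) := forall x, 0 <= mu x <= 1.

Definition fuzzy_incl (X : Type) (mu nu : X -> R) := forall x, mu x <= nu x.

Definition k_condition (V : addSemigroupType) (mu : V -> R) :=
  forall x y, Num.min (mu (x + y)) (mu y) <= mu x.

Definition h_condition (V : addSemigroupType) (mu : V -> R) :=
  forall x z y1 y2, x + y1 + z = y2 + z -> Num.min (mu y1) (mu y2) <= mu x.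

Variables (G : addSemigroupType) (S : gammaSemiringType G).

Definition fuzzy_ideal (mu : S -> R) :=
  [/\ fuzzy_subset mu,
      forall a b : S, Num.min (mu a) (mu b) <= mu (a + b),
      forall (a : S) (al : G) (b : S), mu a <= mu (gmul a al b)
    & forall (a : S) (al : G) (b : S), mu b <= mu (gmul a al b)].

Definition fuzzy_k_ideal (mu : S -> R) := fuzzy_ideal mu /\ k_condition mu.
Definition fuzzy_h_ideal (mu : S -> R) := fuzzy_ideal mu /\ h_condition mu.

Definition fuzzy_ideal_L (mu : left_op S -> R) :=
  [/\ fuzzy_subset mu,
      forall p q : left_op S, Num.min (mu p) (mu q) <= mu (p + q),
      forall p q : left_op S, mu p <= mu (lmul p q)
    & forall p q : left_op S, mu q <= mu (lmul p q)].

Definition fuzzy_k_ideal_L (mu : left_op S -> R) :=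
  fuzzy_ideal_L mu /\ k_condition mu.
Definition fuzzy_h_ideal_L (mu : left_op S -> R) :=
  fuzzy_ideal_L mu /\ h_condition mu.

(* This is sigma^{+'}. The infimum is that of a nonempty set of reals, bounded
   below by 0 as soon as sigma is a fuzzy subset. *)
Definition fuzzy_plus' (sigma : S -> R) : left_op S -> R :=
  fun p => inf [set sigma (lact p a) | a in [set: S]].

Lemma fuzzy_plus'_pi (sigma : S -> R) (u : fsg (S * G)%type) :
  fuzzy_plus' sigma (\pi_(left_op S) u) =
  inf [set sigma (ssum a [seq gmul p.1 p.2 a | p <- fsg_seq u]) | a in [set: S]].
Proof.
congr inf; apply/seteqP.
by split=> _ [a _ <-]; exists a => //; rewrite lact_pi.
Qed.

End Fuzzy.

(* Main.v *)
(** For a fuzzy ideal [mu] of [L] let [fuzzy_plus mu x] be the infimum over [al]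
    of [mu [x, al]]. This is a two-sided inverse of [fuzzy_plus'] on fuzzy
    ideals. If [f] is a right unity then [x] is the sum of the [x g_j f_j],
    which bounds [sigma x] from below by the infimum of the [sigma (x al a)].
    If [e] is a left unity of [S] then [p = p e] is the sum of the
    [[p e_i, d_i]] in [L], which bounds [mu p] from below by the infimum of the
    [mu [p a, al]]. The opposite inequalities hold because [sigma] and [mu]
    are ideals. Both maps are monotone and preserve the k- and h-conditions,
    since [lact p a] is additive in [p] and [[x, al]] is additive in [x]. *)
Require Import Defs.
From HB Require Import structures.
From mathcomp Require Import all_boot all_order all_algebra.
From mathcomp Require Import all_classical all_reals.

Set Implicit Arguments.
Unset Strict Implicit.
Unset Printing Implicit Defensive.

Import Order.TTheory Num.Theory.

Local Open Scope ring_scope.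
Local Open Scope classical_set_scope.

(** * Infima of indexed families of reals *)

Section InfImage.
Variables (R : realType) (I : Type).
Implicit Types f g h : I -> R.

Lemma le_inf_image f c : inhabited I -> (forall i, c <= f i) ->
  c <= inf [set f i | i in [set: I]].
Proof.
move=> [i0] cf; apply: lb_le_inf; first by exists (f i0), i0.
by move=> _ [i _ <-].
Qed.

Lemma inf_image_le f i : (forall j, 0 <= f j) ->
  inf [set f j | j in [set: I]] <= f i.
Proof.
by move=> f0; apply: ge_inf; [exists 0 => _ [j _ <-] | exists i].
Qed.

Lemma ler_inf_image f g : inhabited I -> (forall i, 0 <= f i) ->
  (forall i, f i <= g i) ->
  inf [set f i | i in [set: I]] <= inf [set g i | i in [set: I]].
Proof.
move=> I0 f0 fg; apply: le_inf_image => // i.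
exact: le_trans (inf_image_le i f0) (fg i).
Qed.

(** Closure under [+], the k-condition and the h-condition all bound a value below by a minimum of
    two values; this lemma passes all three to infima. *)
Lemma min_inf_image f g h : inhabited I ->
  (forall i, 0 <= g i) -> (forall i, 0 <= h i) ->
  (forall i, Num.min (g i) (h i) <= f i) ->
  Num.min (inf [set g i | i in [set: I]]) (inf [set h i | i in [set: I]]) <=
  inf [set f i | i in [set: I]].
Proof.
move=> I0 g0 h0 ghf; apply: le_inf_image => // i; apply: le_trans (ghf i).
by rewrite le_min !ge_min (inf_image_le i g0) (inf_image_le i h0) orbT.
Qed.

Lemma inf_image_itv f : inhabited I -> fuzzy_subset f ->
  0 <= inf [set f i | i in [set: I]] <= 1.
Proof.
move=> I0 f01; have f0 i : 0 <= f i by have /andP[] := f01 i.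
rewrite le_inf_image //=; case: I0 => i.
by apply: le_trans (inf_image_le i f0) _; have /andP[] := f01 i.
Qed.

End InfImage.

(** The level set where [mu] is at least [c] is closed under [+]. This turns a decomposition given
    by a unity into a lower bound. *)
Lemma le_ssum (R : realType) (V : addSemigroupType) (mu : V -> R) c x0 s :
  (forall x y, Num.min (mu x) (mu y) <= mu (x + y)) ->
  s != [::] -> (forall x, x \in s -> c <= mu x) -> c <= mu (ssum x0 s).
Proof.
move=> muD; elim: s => // x [|y s] IH _ cs.
  by rewrite ssum1 cs ?mem_head.
rewrite ssum_cons //; apply: le_trans (muD _ _).
rewrite le_min cs ?mem_head //=; apply: IH => // z zs.
by rewrite cs // inE zs orbT.
Qed.

Lemma map_fsg_seq_neq0 (T : choiceType) (U : eqType) (f : T -> U) (u : fsg T) :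
  map f (fsg_seq u) != [::].
Proof. by rewrite -size_eq0 size_map size_eq0 fsg_seq_neq0. Qed.

(** * The generators [[x, al]] of L *)

Section LeftOperatorGenerators.
Variables (G : addSemigroupType) (S : gammaSemiringType G).
Implicit Types (p q : left_op S) (x a b : S) (al be : G).

Definition lgen x al : left_op S :=
  \pi_(left_op S)%qT (@fsg_of_seq (S * G)%type [:: (x, al)] isT).

Lemma lact_lgen x al a : lact (lgen x al) a = gmul x al a.
Proof.
rewrite lact_pi /fact (ssum_perm _ (perm_map _ (perm_fsg_of_seq _))) /=.
exact: ssum1.
Qed.

Lemma lgenD x y al : lgen (x + y) al = lgen x al + lgen y al.
Proof. by apply: lactP => a; rewrite lactD !lact_lgen gmulDl. Qed.

Lemma lgenM x al y be : lgen (gmul x al y) be = lmul (lgen x al) (lgen y be).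
Proof. by apply: lactP => a; rewrite lactM !lact_lgen gmulA. Qed.

(** [lact] takes its own argument as default value of the sum; the sum being nonempty, any default
    serves, as suits [ssum_morph]. *)
Lemma lact_ssum p x0 a :
  lact p a = ssum x0 [seq gmul r.1 r.2 a | r <- fsg_seq (repr p)].
Proof.
have : fsg_seq (repr p) != [::] by exact: fsg_seq_neq0.
rewrite /lact /fact; elim: (fsg_seq _) => // q [|q' s] IH _.
  by rewrite /= !ssum1.
by rewrite [LHS]ssum_cons // [RHS]ssum_cons // IH.
Qed.

Lemma lact_gmul p a al b : lact p (gmul a al b) = gmul (lact p a) al b.
Proof.
rewrite (lact_ssum p b) (lact_ssum p a).
rewrite (@ssum_morph _ _ (fun x => gmul x al b) a b); first 1 last.
- by move=> x y; rewrite gmulDl.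
- exact: map_fsg_seq_neq0.
by rewrite -map_comp; congr ssum; apply: eq_map => q /=; rewrite gmulA.
Qed.

(** Holds because [lact p] commutes with [gmul _ al b]; it links products in L to the action on
    S. *)
Lemma lmul_lgen p a al : lmul p (lgen a al) = lgen (lact p a) al.
Proof. by apply: lactP => b; rewrite lactM !lact_lgen lact_gmul. Qed.

(** The generators span L additively: L acts faithfully on S by [lactP], so comparing actions
    suffices. *)
Lemma left_op_ssum p p0 :
  p = ssum p0 [seq lgen r.1 r.2 | r <- fsg_seq (repr p)].
Proof.
apply: lactP => a.
rewrite (@ssum_morph _ _ (fun q => lact q a) p0 a).
- rewrite -map_comp (lact_ssum p a); congr ssum.
  by apply: eq_map => q /=; rewrite lact_lgen.
- by move=> q r; rewrite lactD.
- exact: map_fsg_seq_neq0.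
Qed.

End LeftOperatorGenerators.

(** * The two maps between fuzzy ideals of S and of L *)

Section FuzzyPlus.
Variables (R : realType) (G : addSemigroupType) (S : gammaSemiringType G).
Implicit Types (sigma tau : S -> R) (mu : left_op S -> R).

Let S0 : inhabited S. Proof. exact: carrier_nonempty. Qed.
Let G0 : inhabited G. Proof. exact: (@gamma_nonempty G S). Qed.

Definition fuzzy_plus mu : S -> R :=
  fun x => inf [set mu (lgen x al) | al in [set: G]].

Lemma fuzzy_ideal_ge0 sigma : fuzzy_ideal sigma -> forall x, 0 <= sigma x.
Proof. by case=> + _ _ _ x => /(_ x)/andP[]. Qed.

Lemma fuzzy_ideal_L_ge0 mu : fuzzy_ideal_L mu -> forall p, 0 <= mu p.
Proof. by case=> + _ _ _ p => /(_ p)/andP[]. Qed.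

Lemma fuzzy_ideal_lact sigma p a :
  fuzzy_ideal sigma -> sigma a <= sigma (lact p a).
Proof.
case=> _ sD _ sr; apply: le_ssum => //.
  exact: map_fsg_seq_neq0.
by move=> _ /mapP[q _ ->]; exact: sr.
Qed.

Lemma fuzzy_plus'_le sigma tau : fuzzy_ideal sigma ->
  fuzzy_incl sigma tau -> fuzzy_incl (fuzzy_plus' sigma) (fuzzy_plus' tau).
Proof.
move=> /fuzzy_ideal_ge0 s0 st p.
exact: ler_inf_image.
Qed.

Lemma fuzzy_plus'_ideal sigma :
  fuzzy_ideal sigma -> fuzzy_ideal_L (fuzzy_plus' sigma).
Proof.
move=> si; have s0 := fuzzy_ideal_ge0 si.
have [s01 sD _ _] := si; split => [p|p q|p q|p q].
- by apply: inf_image_itv => // a; exact: s01.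
- by apply: min_inf_image => // a; rewrite lactD.
- apply: le_inf_image => // a; rewrite lactM.
  (* The infimum at [p] includes the index [b = lact q a]. *)
  exact: (inf_image_le (f := fun b => sigma (lact p b))).
- by apply: ler_inf_image => // a; rewrite lactM fuzzy_ideal_lact.
Qed.

Lemma fuzzy_plus_ideal mu : fuzzy_ideal_L mu -> fuzzy_ideal (fuzzy_plus mu).
Proof.
move=> mi; have m0 := fuzzy_ideal_L_ge0 mi.
have [m01 mD ml mr] := mi; split => [x|x y|x al y|x al y].
- by apply: inf_image_itv => // al; exact: m01.
- by apply: min_inf_image => // al; rewrite lgenD.
- apply: le_inf_image => // be; rewrite lgenM; apply: le_trans (ml _ _).
  exact: (inf_image_le (f := fun ga => mu (lgen x ga))).
- by apply: ler_inf_image => // be; rewrite lgenM.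
Qed.

Lemma fuzzy_plus'_k sigma :
  fuzzy_k_ideal sigma -> fuzzy_k_ideal_L (fuzzy_plus' sigma).
Proof.
move=> [si sk]; split; first exact: fuzzy_plus'_ideal.
move=> p q; have s0 := fuzzy_ideal_ge0 si.
by apply: min_inf_image => // a; rewrite lactD; exact: sk.
Qed.

Lemma fuzzy_plus'_h sigma :
  fuzzy_h_ideal sigma -> fuzzy_h_ideal_L (fuzzy_plus' sigma).
Proof.
move=> [si sh]; split; first exact: fuzzy_plus'_ideal.
move=> p r q1 q2 eq_pr; have s0 := fuzzy_ideal_ge0 si.
(* Acting on [a] turns the equation in L into one in S, with cancelled term [lact r a]. *)
apply: min_inf_image => // a; apply: (sh _ (lact r a)).
by rewrite -!lactD eq_pr.
Qed.

Lemma fuzzy_plus_k mu :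
  fuzzy_k_ideal_L mu -> fuzzy_k_ideal (fuzzy_plus mu).
Proof.
move=> [mi mk]; split; first exact: fuzzy_plus_ideal.
move=> x y; have m0 := fuzzy_ideal_L_ge0 mi.
by apply: min_inf_image => // al; rewrite lgenD; exact: mk.
Qed.

Lemma fuzzy_plus_h mu :
  fuzzy_h_ideal_L mu -> fuzzy_h_ideal (fuzzy_plus mu).
Proof.
move=> [mi mh]; split; first exact: fuzzy_plus_ideal.
move=> x z y1 y2 eq_xz; have m0 := fuzzy_ideal_L_ge0 mi.
apply: min_inf_image => // al; apply: (mh _ (lgen z al)).
by rewrite -!lgenD eq_xz.
Qed.

Lemma fuzzy_plus'K sigma : has_right_unity S -> fuzzy_ideal sigma ->
  fuzzy_plus (fuzzy_plus' sigma) = sigma.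
Proof.
move=> [f fE] si; have s0 := fuzzy_ideal_ge0 si.
have s'0 := fuzzy_ideal_L_ge0 (fuzzy_plus'_ideal si).
have [_ sD sl _] := si.
apply/funext => x; apply/le_anti/andP; split; last first.
  (* Each term is some [sigma (gmul x al a)], at least [sigma x]. *)
  by do 2![apply: le_inf_image => // ?]; rewrite lact_lgen.
rewrite -[leRHS]/(sigma x) -[in leRHS](fE x); apply: le_ssum => //.
  exact: map_fsg_seq_neq0.
move=> _ /mapP[[ga b] _ ->] /=.
(* The double infimum is at most its term at [ga] and [b], the pair taken from the right unity. *)
apply: le_trans (inf_image_le ga (fun al => s'0 (lgen x al))) _.
rewrite -lact_lgen.
exact: (inf_image_le (f := fun a => sigma (lact (lgen x ga) a))).
Qed.

Lemma fuzzy_plusK mu : has_left_unity S -> fuzzy_ideal_L mu ->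
  fuzzy_plus' (fuzzy_plus mu) = mu.
Proof.
move=> [e eE] mi; have m0 := fuzzy_ideal_L_ge0 mi.
have m'0 := fuzzy_ideal_ge0 (fuzzy_plus_ideal mi).
have [_ mD ml _] := mi.
apply/funext => p; apply/le_anti/andP; split; last first.
  by do 2![apply: le_inf_image => // ?]; rewrite -lmul_lgen.
have gens0 : [seq lgen r.1 r.2 | r <- fsg_seq (repr e)] != [::].
  exact: map_fsg_seq_neq0.
have pE : p = ssum p [seq lmul p q |
    q <- [seq lgen r.1 r.2 | r <- fsg_seq (repr e)]].
  rewrite -(@ssum_morph _ _ (lmul p) e p) //; last exact: lmulDr.
  (* A left unity of S is a right identity of L, since [lact p (lact e a) = lact p a]. *)
  by rewrite -left_op_ssum; apply: lactP => a; rewrite lactM eE.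
rewrite [in leRHS]pE; apply: le_ssum => //.
  by rewrite -size_eq0 size_map size_eq0.
move=> _ /mapP[_ /mapP[[a al] _ ->] ->]; rewrite lmul_lgen /=.
apply: le_trans (inf_image_le a (fun b => m'0 (lact p b))) _.
exact: (inf_image_le (f := fun be => mu (lgen (lact p a) be))).
Qed.

(** Stated for arbitrary classes [P] and [Q] of fuzzy ideals exchanged by the two maps, so that the
    k- and h-cases share one argument. *)
Lemma fuzzy_plus'_bij (P : set (S -> R)) (Q : set (left_op S -> R)) :
  has_left_unity S -> has_right_unity S ->
  (forall sigma, P sigma -> fuzzy_ideal sigma) ->
  (forall mu, Q mu -> fuzzy_ideal_L mu) ->
  (forall sigma, P sigma -> Q (fuzzy_plus' sigma)) ->
  (forall mu, Q mu -> P (fuzzy_plus mu)) ->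
  set_bij P Q (@fuzzy_plus' R G S).
Proof.
move=> lu ru Pi Qi PQ QP; split => [|sigma tau|mu Qmu].
- exact: PQ.
- rewrite !inE => /Pi si /Pi ti st.
  by rewrite -(fuzzy_plus'K ru si) st fuzzy_plus'K.
- by exists (fuzzy_plus mu); [exact: QP | rewrite fuzzy_plusK //; exact: Qi].
Qed.

End FuzzyPlus.

Theorem theorem3p12 (R : realType) (G : addSemigroupType)
    (S : gammaSemiringType G)
    (left_unity : has_left_unity S) (right_unity : has_right_unity S) :
  (set_bij [set sigma : S -> R | fuzzy_k_ideal sigma]
           [set mu : left_op S -> R | fuzzy_k_ideal_L mu]
           (fun sigma : S -> R => fuzzy_plus' sigma) /\
   (forall sigma tau : S -> R, fuzzy_k_ideal sigma -> fuzzy_k_ideal tau ->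
      fuzzy_incl sigma tau -> fuzzy_incl (fuzzy_plus' sigma) (fuzzy_plus' tau)))
  /\
  (set_bij [set sigma : S -> R | fuzzy_h_ideal sigma]
           [set mu : left_op S -> R | fuzzy_h_ideal_L mu]
           (fun sigma : S -> R => fuzzy_plus' sigma) /\
   (forall sigma tau : S -> R, fuzzy_h_ideal sigma -> fuzzy_h_ideal tau ->
      fuzzy_incl sigma tau -> fuzzy_incl (fuzzy_plus' sigma) (fuzzy_plus' tau))).
Proof.
split; split=> [|sigma tau [si _] _]; try exact: fuzzy_plus'_le.
- apply: fuzzy_plus'_bij => //; first by move=> ? [].
  + by move=> ? [].
  + exact: fuzzy_plus'_k.
  + exact: fuzzy_plus_k.
- apply: fuzzy_plus'_bij => //; first by move=> ? [].
  + by move=> ? [].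
  + exact: fuzzy_plus'_h.
  + exact: fuzzy_plus_h.
Qed.
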